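(* For any $(j,S,c)$ skeleton construction with support $U$, let $p(U)$ be the minimum number of proper boxes of $\{0,1,2\}^j$ that partition $U$. Then $p(U)+c\ge 2^j$. Consequently $$S+c\ \ge\ 2^j+\bigl(S-p(U)\bigr),$$ and any skeleton construction with $S+c\le 2^j$ must satisfy $p(U)\ge S$.
   Context: Write $[3]=\{0,1,2\}$. A proper box in $[3]^j$ is a set $S_1\times\dots\times S_j$ with $\varnothing\neq S_i\subsetneq[3]$ for every $i$. For $t\in[3]^j$ the all-pair box of $t$ is $A_t=\prod_{i=1}^j([3]\setminus\{t_i\})$. A $(j,S,c)$ skeleton construction consists of a set $T\subseteq[3]^j$ with $|T|=S$ such that $N(x)=\#\{t\in T: x\in A_t\}\in\{0,2\}$ for all $x\in[3]^j$, together with $c$ proper boxes of $[3]^j$ that partition the hole-set $H=\{x: N(x)=0\}$ (pairwise disjoint with union $H$). Its support is $U=\{x: N(x)=2\}$. A family of boxes partitions a set if the boxes are pairwise disjoint with union that set. The theorem of Alon, Bohman, Holzman and Kleitman states that any partition of $[3]^j$ into proper boxes has at least $2^j$ members. *)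

(* Defs.v *)
From mathcomp Require Import all_boot all_order all_algebra.

Set Implicit Arguments.
Unset Strict Implicit.
Unset Printing Implicit Defensive.

Definition point (j : nat) := {ffun 'I_j -> 'I_3}.

Definition box (j : nat) (F : 'I_j -> {set 'I_3}) : {set point j} :=
  [set x : point j | [forall i, x i \in F i]].

Definition proper_box (j : nat) (B : {set point j}) : bool :=
  [exists F : {ffun 'I_j -> {set 'I_3}},
     [forall i, (F i != set0) && (F i \proper [set: 'I_3])] && (B == box F)].

(* Proper boxes are nonempty, so pairwise disjoint members of a family are
   distinct: families can be taken as sets of boxes, and the requirement
   [set0 \notin P] contained in [partition P A] is harmless. *)
Definition box_partition (j : nat) (P : {set {set point j}})
    (A : {set point j}) : bool :=
  partition P A && [forall B in P, proper_box B].

Definition all_pair_box (j : nat) (t : point j) : {set point j} :=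
  box (fun i => ~: [set t i]).

Definition cover_count (j : nat) (T : {set point j}) (x : point j) : nat :=
  #|[set t in T | x \in all_pair_box t]|.

Definition hole_set (j : nat) (T : {set point j}) : {set point j} :=
  [set x | cover_count T x == 0].

Record skeleton (j s c : nat) := Skeleton {
  skel_T : {set point j};
  skel_holes : {set {set point j}};
  card_skel_T : #|skel_T| = s;
  skel_count : forall x, cover_count skel_T x = 0 \/ cover_count skel_T x = 2;
  skel_holesP : box_partition skel_holes (hole_set skel_T);
  card_skel_holes : #|skel_holes| = c
}.

Definition skel_support (j s c : nat) (K : skeleton j s c) : {set point j} :=
  [set x | cover_count (skel_T K) x == 2].

Definition partitionable_into (j : nat) (A : {set point j}) (n : nat) : bool :=
  [exists P : {set {set point j}}, box_partition P A && (#|P| == n)].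

Lemma proper_box1 (j : nat) (x : point j) : proper_box [set x].
Proof.
apply/existsP; exists [ffun i => [set x i]]; apply/andP; split.
  apply/forallP=> i; rewrite ffunE properEcard subsetT cards1 cardsT card_ord.
  by rewrite andbT -card_gt0 cards1.
apply/eqP/setP=> y; rewrite !inE; apply/eqP/forallP=> [-> i|xy].
  by rewrite ffunE inE.
by apply/ffunP=> i; have := xy i; rewrite ffunE inE => /eqP.
Qed.

Lemma ex_partitionable (j : nat) (A : {set point j}) :
  exists n, partitionable_into A n.
Proof.
exists #|[set [set x] | x in A]|; apply/existsP; exists [set [set x] | x in A].
rewrite eqxx andbT; apply/andP; split; last first.
  by apply/forall_inP=> _ /imsetP[x _ ->]; apply: proper_box1.
apply/and3P; split.
- apply/eqP/setP=> x; apply/bigcupP/idP=> [[_ /imsetP[y yA ->]]|xA].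
    by rewrite inE => /eqP->.
  by exists [set x]; rewrite ?inE //; apply: imset_f.
- apply/trivIsetP=> _ _ /imsetP[x _ ->] /imsetP[y _ ->] neq.
  rewrite disjoints1 inE; apply: contraNneq neq => ->; exact: eqxx.
- by apply/imsetP=> -[x _ /setP/(_ x)]; rewrite !inE eqxx.
Qed.

Definition min_box_partition (j : nat) (A : {set point j}) : nat :=
  ex_minn (ex_partitionable A).

(* Main.v *)
Require Import Defs.
From mathcomp Require Import all_boot all_order all_algebra.
From mathcomp Require Import zify.

Set Implicit Arguments.
Unset Strict Implicit.
Unset Printing Implicit Defensive.

(** The union of a partition of the support and of the partition of the holes
    is a partition of the whole cube, so everything rests on the theorem of
    Alon, Bohman, Holzman and Kleitman, proved as follows. Take products R of
    odd-size subsets of [3]. Since R has odd size, it meets some member of the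
    partition in an odd number of points. But a fixed proper box B meets only
    the fraction 2^-j of all such R oddly: |R n B| is odd iff every |R_i n S_i|
    is odd, and toggling in R_i one point of S_i and one point outside it shows
    that this happens for exactly half of the odd sets R_i. *)

Section Toggle.

Context {T : finType}.
Implicit Types (A S : {set T}) (x : T).

Definition toggle x A : {set T} := [set y | (y \in A) (+) (y == x)].

Lemma toggleK x : involutive (toggle x).
Proof. by move=> A; apply/setP=> y; rewrite !inE addbK. Qed.

Lemma odd_toggleI x A S :
  odd #|toggle x A :&: S| = odd #|A :&: S| (+) (x \in S).
Proof.
rewrite (cardsD1 x) [in RHS](cardsD1 x) !inE eqxx.
rewrite (_ : (toggle x A :&: S) :\ x = (A :&: S) :\ x); last first.
  by apply/setP=> y; rewrite !inE; case: eqP => // _; rewrite addbF.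
by rewrite !oddD !oddb; case: (x \in A); case: (x \in S); case: (odd _).
Qed.

Lemma odd_toggle x A : odd #|toggle x A| = ~~ odd #|A|.
Proof. by have := odd_toggleI x A setT; rewrite !setIT inE addbT. Qed.

Definition odd_sets : {set {set T}} := [set A : {set T} | odd #|A|].

Definition odd_meeting S : {set {set T}} :=
  [set A in odd_sets | odd #|A :&: S|].

Lemma card_odd_meeting S :
  S != set0 -> S \proper setT -> 2 * #|odd_meeting S| = #|odd_sets|.
Proof.
case/set0Pn=> a aS /properP[_ [b _ bNS]].
have flipI : injective (toggle a \o toggle b).
  by apply: inj_comp; apply: inv_inj; apply: toggleK.
(* One of the two copies of [odd_meeting S] is replaced by its image under the double toggle. Two
   toggles preserve the parity of [#|A|], and only [a] affects that of [#|A :&: S|], so this image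
   is the rest of [odd_sets]. *)
rewrite mul2n -addnn -{2}(card_imset _ flipI).
rewrite -(cardsID [set A : {set T} | odd #|A :&: S|] odd_sets); congr (_ + _).
  by apply: eq_card => A; rewrite !inE.
apply: eq_card => A; rewrite !inE; apply/imsetP/andP.
  case=> B; rewrite !inE => /andP[oB oBS] ->.
  by rewrite /= !odd_toggle !odd_toggleI oB oBS aS (negbTE bNS).
case=> eAS oA; exists (toggle b (toggle a A)); last by rewrite /= !toggleK.
by rewrite !inE !odd_toggle !odd_toggleI oA (negbTE eAS) aS (negbTE bNS).
Qed.

End Toggle.

Lemma card_ffun_forall (I T : finType) (F : I -> {set T}) :
  #|[set f : {ffun I -> T} | [forall i, f i \in F i]]| = \prod_i #|F i|.
Proof.
rewrite cardsE; have := card_family (fun i => mem (F i)).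
by rewrite foldrE big_image.
Qed.

Lemma odd_prod (I : finType) (f : I -> nat) :
  odd (\prod_i f i) = [forall i, odd (f i)].
Proof. by rewrite (big_morph odd oddM (erefl _ : odd 1 = true)) big_andE. Qed.

Lemma card_bigcup_le (I T : finType) (P : {set I}) (F : I -> {set T}) :
  #|\bigcup_(i in P) F i| <= \sum_(i in P) #|F i|.
Proof.
elim/big_rec2: _ => [|i n A _ le_An]; first by rewrite cards0.
by rewrite (leq_trans (leq_card_setU _ _)) // leq_add2l.
Qed.

Section ProperBoxPartition.

Variable j : nat.
Implicit Types (P Q : {set {set point j}}) (A B : {set point j}).

Definition odd_boxes : {set {ffun 'I_j -> {set 'I_3}}} :=
  [set R : {ffun 'I_j -> {set 'I_3}} | [forall i, R i \in odd_sets]].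

Lemma odd_boxI (R F : 'I_j -> {set 'I_3}) :
  odd #|box R :&: box F| = [forall i, odd #|R i :&: F i|].
Proof.
rewrite -odd_prod -card_ffun_forall; congr odd.
apply: eq_card => x; rewrite !inE; apply/andP/forallP.
  by case=> /forallP xR /forallP xF i; rewrite inE xR xF.
by move=> xRF; split; apply/forallP=> i; have := xRF i; rewrite inE => /andP[].
Qed.

(** Both families of boxes are defined side by side, so their sizes are products over the
    coordinates, and each coordinate contributes one factor 2. *)
Lemma card_odd_boxes_meeting B : proper_box B ->
  2 ^ j * #|[set R in odd_boxes | odd #|box R :&: B|]| = #|odd_boxes|.
Proof.
case/existsP=> F /andP[/forallP properF /eqP->].
rewrite (_ : [set R in _ | _] = [set R : {ffun 'I_j -> {set 'I_3}} |
  [forall i, R i \in odd_meeting (F i)]]); last first.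
  apply/setP=> R; rewrite !inE odd_boxI; apply/andP/forallP.
    by case=> /forallP oR /forallP oRF i; rewrite inE oR oRF.
  by move=> oRF; split; apply/forallP=> i; have := oRF i; rewrite inE => /andP[].
rewrite !card_ffun_forall -[j in 2 ^ j]card_ord -prod_nat_const -big_split /=.
by apply: eq_bigr => i _; case/andP: (properF i); apply: card_odd_meeting.
Qed.

(** The size of [box R] is a product of odd numbers and also the sum of [#|box R :&: B|] over [B] in
    [P]; these terms cannot all be even. *)
Lemma odd_box_meets P (R : {ffun 'I_j -> {set 'I_3}}) :
  partition P setT -> R \in odd_boxes ->
  exists2 B, B \in P & odd #|box R :&: B|.
Proof.
case/and3P=> /eqP coverP trivP _; rewrite inE => oddR.
apply/exists_inP; apply: contraTT oddR => /exists_inPn evenP.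
under eq_forallb do rewrite inE.
rewrite -odd_prod -card_ffun_forall -sum1_card.
rewrite (eq_bigl (fun x => (x \in cover P) && (x \in box R))); last first.
  by move=> x; rewrite coverP in_setT.
rewrite big_trivIset_cond //.
apply: (big_ind (fun n => ~~ odd n)) => // [m n|B BP].
  by rewrite oddD => /negbTE-> /negbTE->.
rewrite (eq_bigl (mem (box R :&: B))) => [|x]; last by rewrite !inE andbC.
by rewrite sum1_card evenP.
Qed.

(* Alon, Bohman, Holzman and Kleitman. *)
Lemma card_proper_box_partition P : box_partition P setT -> 2 ^ j <= #|P|.
Proof.
case/andP=> partP /forall_inP properP.
have odd_gt0 : 0 < #|odd_boxes|.
  apply/card_gt0P; exists [ffun=> [set ord0]]; rewrite inE.
  by apply/forallP=> i; rewrite ffunE inE cards1.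
(* Double counting: each member of [P] is weighted by [#|odd_boxes|], which is [2 ^ j] times the
   number of odd boxes it meets oddly. After cancelling [2 ^ j], a union bound suffices. *)
rewrite -(leq_pmul2r odd_gt0) -sum_nat_const.
under eq_bigr => B BP do rewrite -(card_odd_boxes_meeting (properP B BP)).
rewrite -big_distrr leq_mul2l; apply/orP; right.
apply: leq_trans (card_bigcup_le _ _); apply/subset_leq_card/subsetP=> R oR.
have [B BP oRB] := odd_box_meets partP oR.
by apply/bigcupP; exists B; rewrite // inE oR.
Qed.

Lemma box_partitionU P Q A B : [disjoint A & B] ->
  box_partition P A -> box_partition Q B -> box_partition (P :|: Q) (A :|: B).
Proof.
move=> disAB /andP[partP /forall_inP boxP] /andP[partQ /forall_inP boxQ].
apply/andP; split; last first.
  by apply/forall_inP=> C /setUP[/boxP|/boxQ].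
case/and3P: partP partQ => /eqP covP trivP P0 /and3P[/eqP covQ trivQ Q0].
apply/and3P; split; last by rewrite inE negb_or P0.
  by rewrite /cover bigcup_setU -/(cover P) -/(cover Q) covP covQ.
(* Members of [P] lie inside [A] and members of [Q] inside [B]. *)
have disPQ C D : C \in P -> D \in Q -> [disjoint C & D].
  move=> CP DQ; apply: disjointWl (disjointWr _ disAB).
    by rewrite -covP; apply: (bigcup_sup C).
  by rewrite -covQ; apply: (bigcup_sup D).
apply/trivIsetP=> C D /setUP[CP|CQ] /setUP[DP|DQ] neqCD.
- by move/trivIsetP: trivP; apply.
- exact: disPQ.
- by rewrite disjoint_sym; apply: disPQ.
- by move/trivIsetP: trivQ; apply.
Qed.

End ProperBoxPartition.

Lemma min_box_partitionP (j : nat) (A : {set point j}) :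
  exists2 P, box_partition P A & #|P| = min_box_partition A.
Proof.
rewrite /min_box_partition; case: ex_minnP => n /existsP[P /andP[partP /eqP cP]] _.
by exists P.
Qed.

Lemma skel_support_holes (j s c : nat) (K : skeleton j s c) :
  skel_support K :|: hole_set (skel_T K) = setT.
Proof. by apply/setP=> x; rewrite !inE; case: (skel_count K x) => ->. Qed.

(* The middle inequality is over the integers because S - p(U) may be
   negative. *)
Theorem proposition8p2 (j s c : nat) (K : skeleton j s c) :
  [/\ 2 ^ j <= min_box_partition (skel_support K) + c,
      ((2 ^ j)%N%:Z + (s%:Z - (min_box_partition (skel_support K))%:Z)
         <= s%:Z + c%:Z)%R
    & s + c <= 2 ^ j -> s <= min_box_partition (skel_support K)].
Proof.
have le_pc : 2 ^ j <= min_box_partition (skel_support K) + c.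
  have [P partP <-] := min_box_partitionP (skel_support K).
  rewrite -(card_skel_holes K).
  apply: leq_trans (leq_card_setU _ _).
  apply: card_proper_box_partition; rewrite -(skel_support_holes K).
  apply: box_partitionU partP (skel_holesP K).
  (* No point is covered both 0 and 2 times. *)
  by apply/pred0P=> x; rewrite /= !inE; case: (skel_count K x) => ->.
(* With the power abstracted to [n], both remaining claims are linear consequences of [le_pc]. *)
by split; [|move: (2 ^ j) le_pc => n; lia..].
Qed.
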